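(* There exists an absolute constant $c>0$ such that for every $n\geq 1$ and every log-concave probability measure $\mu$ on $\mathbb{R}^n$, $$\int_{\mathbb{R}^n}\varphi_{\mu}(x)\,d\mu(x)\geq e^{-cn}.$$
   Context: A log-concave probability measure on $\mathbb{R}^n$ is a Borel probability measure $\mu$ such that $\mu(\lambda A+(1-\lambda)B)\geq \mu(A)^{\lambda}\mu(B)^{1-\lambda}$ for all compact $A,B\subseteq\mathbb{R}^n$ and $\lambda\in(0,1)$, and $\mu(H)<1$ for every hyperplane $H$. Tukey's half-space depth is $\varphi_\mu(x)=\inf\{\mu(H): H$ a half-space of $\mathbb{R}^n$ containing $x\}$. *)

(* Defs.v *)
From HB Require Import structures.
From mathcomp Require Import all_boot all_order all_algebra.
From mathcomp Require Import all_classical all_reals all_analysis.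
Set Implicit Arguments. Unset Strict Implicit. Unset Printing Implicit Defensive.
Import Order.TTheory GRing.Theory Num.Theory.
Import numFieldNormedType.Exports.
Local Open Scope classical_set_scope.
Local Open Scope ring_scope.

Definition Rn (R : realType) (n : nat) : Type :=
  g_sigma_algebraType (open : set_system 'rV[R]_n).

Definition dotRn (R : realType) (n : nat) (u x : 'rV[R]_n) : R :=
  \sum_(i < n) u ord0 i * x ord0 i.

Definition halfspaces (R : realType) (n : nat) : set (set 'rV[R]_n) :=
  [set H | exists (u : 'rV[R]_n) (a : R), u != 0 /\
           H = [set y | a <= dotRn u y]].

Definition hyperplanes (R : realType) (n : nat) : set (set 'rV[R]_n) :=
  [set H | exists (u : 'rV[R]_n) (a : R), u != 0 /\
           H = [set y | dotRn u y = a]].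

Definition minkowski_comb (R : realType) (n : nat) (l : R)
    (A B : set 'rV[R]_n) : set 'rV[R]_n :=
  [set l *: a + (1 - l) *: b | a in A & b in B].

Definition log_concave (R : realType) (n : nat)
    (mu : probability (Rn R n) R) : Prop :=
  (forall (A B : set 'rV[R]_n) (l : R), compact A -> compact B ->
     0 < l < 1 ->
     (((fine (mu A)) `^ l * (fine (mu B)) `^ (1 - l))%:E
       <= mu (minkowski_comb l A B :  set (Rn R n)))%E) /\
  (forall H : set 'rV[R]_n, hyperplanes H -> (mu (H : set (Rn R n)) < 1)%E).

Definition tukey_depth (R : realType) (n : nat)
    (mu : probability (Rn R n) R) (x : 'rV[R]_n) : \bar R :=
  ereal_inf [set mu (H : set (Rn R n)) | H in [set H | halfspaces H /\ H x]].

(* Main.v *)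
Require Import Defs.
From HB Require Import structures.
From mathcomp Require Import all_boot all_order all_algebra.
From mathcomp Require Import all_classical all_reals all_analysis.
From mathcomp Require Import measurable_realfun.
From mathcomp Require Import zify ring lra.
Import Order.TTheory GRing.Theory Num.Theory.
Import numFieldNormedType.Exports.
Local Open Scope classical_set_scope.
Local Open Scope ring_scope.

(* For a density f the argument reads as follows.  A half-space containing x
   contains x+v or x-v for every v, so that
   phi(x) >= (1/2) int min(f(x+v), f(x-v)) dv.  Since min(s, t) >= s t / M for
   M = max f, and f(x)^2 >= f(x+v) f(x-v) by log-concavity,
     int phi f >= (1/2) int int f(x) min(f(x+v), f(x-v)) dv dx
               >= 2^-(n+1) (int f^(3/2))^2 / M,
   and int f^(3/2) >= (int f)^2 / int f^(1/2) by Cauchy-Schwarz, where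
   M^(1/2) int f^(1/2) <= int f((x + x_max)/2) dx = 2^n.
   The definition of log-concavity provides no density, so the integrals are
   replaced by sums over the cells of a grid of mesh r, using that the midpoint
   set of two closed cells is again a cube.  This bounds the measures of
   half-spaces widened by O(r), and r tends to 0. *)

(** * Inequalities for finite sums *)

Lemma sum_sqr_le_sum_cube (R : realType) (K : finType) (s : K -> R) :
  (forall k, 0 <= s k) ->
  (\sum_k s k ^+ 2) ^+ 2 <= (\sum_k s k ^+ 3) * (\sum_k s k).
Proof.
move=> s0.
(* This double sum of nonnegative terms is twice the defect in the Cauchy-Schwarz inequality for
   s^(3/2) and s^(1/2). *)
have : 0 <= \sum_k \sum_l s k * s l * (s k - s l) ^+ 2.
  apply: sumr_ge0 => k _; apply: sumr_ge0 => l _.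
  by apply: mulr_ge0 (sqr_ge0 _); exact: mulr_ge0.
have -> : \sum_k \sum_l s k * s l * (s k - s l) ^+ 2 =
    ((\sum_k s k ^+ 3) * (\sum_k s k) - (\sum_k s k ^+ 2) ^+ 2) *+ 2.
  have e1 : (\sum_k s k ^+ 3) * (\sum_k s k) = \sum_k \sum_l s k ^+ 3 * s l.
    by rewrite mulr_suml; apply: eq_bigr => k _; rewrite mulr_sumr.
  have e2 : (\sum_k s k ^+ 3) * (\sum_k s k) = \sum_k \sum_l s k * s l ^+ 3.
    by rewrite mulrC mulr_suml; apply: eq_bigr => k _; rewrite mulr_sumr.
  have e3 : (\sum_k s k ^+ 2) ^+ 2 = \sum_k \sum_l s k ^+ 2 * s l ^+ 2.
    by rewrite expr2 mulr_suml; apply: eq_bigr => k _; rewrite mulr_sumr.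
  rewrite mulr2n {1}e1 e2 e3 -!sumrB -big_split/=; apply: eq_bigr => k _.
  by rewrite -!sumrB -big_split/=; apply: eq_bigr => l _; ring.
by rewrite pmulrn_lge0// subr_ge0.
Qed.

(* Discrete form of the estimate for a log-concave density f with maximum S^2:
   int int f(x) min(f(x+v), f(x-v)) is at least a constant times
   (int f^(3/2) / S)^2, while log-concavity gives S * int f^(1/2) <= T. *)
Lemma sum_min_ge (R : realType) (K : finType) (p : K -> R) (q : K -> K -> R)
    (T : R) :
  0 < T -> (forall k, 0 <= p k) -> 2^-1 <= \sum_k p k ->
  (forall k l, Num.sqrt (p k) * Num.sqrt (p l) <= q k l) ->
  (forall l, \sum_k q k l <= T) ->
  (16 * T ^+ 2)^-1 <= \sum_k \sum_l Num.min (p k) (p l) * q k l.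
Proof.
move=> T0 p0 sp pq qT; pose s k := Num.sqrt (p k).
have s0 k : 0 <= s k by exact: sqrtr_ge0.
have s2 k : s k ^+ 2 = p k by rewrite sqr_sqrtr.
have [k0 pk0] : exists k0, 0 < p k0.
  apply: contrapT => /forallNP np.
  have : \sum_k p k <= 0 by apply: sumr_le0 => k _; rewrite leNgt; apply/negP.
  by lra.
(* The index [m] plays the part of x_max; summing the bound on [q k m] over [k] gives
   [A * s m <= T]. *)
pose m := [arg max_(k > k0) s k]%O.
have mP k : s k <= s m by rewrite /m; case: arg_maxP => // i _; apply.
have sm0 : 0 < s m by apply: lt_le_trans (mP k0); rewrite sqrtr_gt0.
set A := \sum_k s k; set C := \sum_k s k ^+ 3.
have AT : A * s m <= T.
  by apply: le_trans (qT m); rewrite mulr_suml; apply: ler_sum => k _; exact: pq.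
have C0 : 0 <= C by apply: sumr_ge0 => k _; rewrite exprn_ge0.
have CA : 4^-1 <= C * A.
  apply: le_trans (sum_sqr_le_sum_cube _ _ _ s0).
  under eq_bigr do rewrite s2.
  by nra.
have CT : s m <= 4 * C * T.
  have : C * (A * s m) <= C * T by apply: ler_wpM2l.
  have : 4^-1 * s m <= C * A * s m by rewrite ler_wpM2r// ltW.
  by nra.
(* Termwise, min(p k, p l) >= p k * p l / (s m)^2 and q k l >= s k * s l; the resulting double sum
   factors as (C / s m)^2. *)
apply: (@le_trans _ _ (\sum_k \sum_l (s k ^+ 3 * s l ^+ 3 / s m ^+ 2))).
  have -> : \sum_k \sum_l (s k ^+ 3 * s l ^+ 3 / s m ^+ 2) = (C / s m) ^+ 2.
    rewrite exprMn exprVn [C ^+ 2]expr2 -mulrA {1}/C mulr_suml.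
    apply: eq_bigr => k _; rewrite /C mulr_suml mulr_sumr.
    by apply: eq_bigr => l _; rewrite mulrA.
  have -> : (16 * T ^+ 2)^-1 = ((4 * T)^-1) ^+ 2 by field; lra.
  have le : (4 * T)^-1 <= C / s m.
    by rewrite ler_pdivlMr// ler_pdivrMl; lra.
  have : 0 <= (4 * T)^-1 by rewrite invr_ge0; lra.
  by nra.
apply: ler_sum => k _; apply: ler_sum => l _.
have H (a b : R) : 0 <= a -> 0 <= b -> a <= s m -> b <= s m ->
    a ^+ 2 * b ^+ 2 / s m ^+ 2 <= a ^+ 2.
  move=> a0 b0 am bm; rewrite ler_pdivrMr ?exprn_gt0// ler_wpM2l ?sqr_ge0//.
  by rewrite lerXn2r ?nnegrE// ltW.
have -> : s k ^+ 3 * s l ^+ 3 / s m ^+ 2 =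
   (s k ^+ 2 * s l ^+ 2 / s m ^+ 2) * (s k * s l) by ring.
apply: ler_pM => //.
- by apply: divr_ge0; [apply: mulr_ge0|]; exact: sqr_ge0.
- by rewrite mulr_ge0.
- by rewrite le_min -!s2 H// mulrC [_ ^+ 2 * _]mulrC mulrC H.
- exact: pq.
Qed.

(** * Sums of indicators under a probability measure *)

Section probability_sums.
Context (d : measure_display) (X : measurableType d) (R : realType).
Variable P : probability X R.

Lemma EFin_fine_probability (A : set X) : measurable A -> (fine (P A))%:E = P A.
Proof. by move=> mA; rewrite fineK// fin_num_measure. Qed.

Lemma integral_sum_indic (I : finType) (w : I -> R) (A : I -> set X) :
  (forall i, 0 <= w i) -> (forall i, measurable (A i)) ->
  (\int[P]_x (\sum_i w i * \1_(A i) x)%:E = (\sum_i w i * fine (P (A i)))%:E)%E.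
Proof.
move=> w0 mA.
under eq_integral do rewrite -sumEFin.
rewrite ge0_integral_sum//; first last.
- by move=> i x _; rewrite lee_fin mulr_ge0.
- by move=> i; apply/measurable_EFinP; apply: measurable_funM => //.
rewrite -sumEFin; apply: eq_bigr => i _.
rewrite (integralZl_indic _ (fun=> A i))//; last by move/lt_geF; rewrite w0.
by rewrite integral_indic// setIT EFinM EFin_fine_probability.
Qed.

Lemma sum_measure_le (I J : finType) (w : I -> R) (v : J -> R)
    (A : I -> set X) (B : J -> set X) :
  (forall i, 0 <= w i) -> (forall j, 0 <= v j) ->
  (forall i, measurable (A i)) -> (forall j, measurable (B j)) ->
  (forall x, \sum_i w i * \1_(A i) x <= \sum_j v j * \1_(B j) x) ->
  \sum_i w i * fine (P (A i)) <= \sum_j v j * fine (P (B j)).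
Proof.
move=> w0 v0 mA mB le.
rewrite -lee_fin -!integral_sum_indic//; apply: ge0_le_integral => //.
- by move=> x _; rewrite lee_fin sumr_ge0// => i _; rewrite mulr_ge0.
- apply/measurable_EFinP; apply: measurable_sum => i.
  by apply: measurable_funM.
- apply/measurable_EFinP; apply: measurable_sum => i.
  by apply: measurable_funM.
- by move=> x _; rewrite lee_fin.
Qed.

(** If g is the weighted sum and B the set where g >= c, then g <= 1_B + c pointwise, and
    integration gives 2c <= P(B) + c. *)
Lemma probability_sum_ge (I : finType) (w : I -> R) (A : I -> set X) (c : R) :
  0 <= c ->
  (forall i, 0 <= w i) -> (forall i, measurable (A i)) ->
  (forall x, \sum_i w i * \1_(A i) x <= 1) ->
  c *+ 2 <= \sum_i w i * fine (P (A i)) ->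
  (c%:E <= P [set x | (c <= \sum_i w i * \1_(A i) x)%R])%E.
Proof.
move=> c0 w0 mA g1 cg; set B := [set x | _].
have mB : measurable B.
  rewrite -[B]setTI; apply: measurable_fun_le => //.
  by apply: measurable_sum => i; apply: measurable_funM.
have := @sum_measure_le I bool w (fun b => if b then 1 else c) A
  (fun b => if b then B else setT).
rewrite !big_bool/= probability_setT/= -(EFin_fine_probability _ mB) lee_fin => H.
suff : \sum_i w i * fine (P (A i)) <= 1 * fine (P B) + c * 1 by lra.
apply: H => //; [by case|by case|move=> x].
rewrite big_bool/= !indicE in_setT mulr1 mul1r.
have [xB|/negP xB] := boolP (x \in B).
  by apply: (le_trans (g1 x)); rewrite lerDl.
rewrite add0r leNgt; apply/negP => cx; apply: xB; rewrite inE /B/=.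
exact: ltW.
Qed.

End probability_sums.

(** The integral of a nonnegative function is a supremum over the simple functions below it, and c
    1_E is one of them. The bound thus applies to the Tukey depth without a study of its
    measurability. *)
Lemma integral_ge_indic (d : measure_display) (X : measurableType d)
    (R : realType) (mu : {measure set X -> \bar R}) (f : X -> \bar R)
    (c : R) (E : set X) :
  (forall x, 0 <= f x)%E -> 0 <= c -> measurable E ->
  (forall x, E x -> c%:E <= f x)%E ->
  (c%:E * mu E <= \int[mu]_x f x)%E.
Proof.
move=> f0 c0 mE cf; rewrite ge0_integralTE//.
pose h := scale_nnsfun (indic_nnsfun R mE) c0.
apply: ereal_sup_ubound; exists h => /=.
  move=> x; rewrite mindicE; have [xE|_] := boolP (x \in E).
    by rewrite mulr1 cf// -inE.
  by rewrite mulr0.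
by rewrite sintegralrM sintegral_indic.
Qed.

(** * Cubes and their midpoint sets *)

Definition cbox (R : realType) (n : nat) (b : 'I_n -> R) (r : R) :
    set 'rV[R]_n :=
  [set x | forall i, b i <= x ord0 i <= b i + r].

(** Half-open cubes give disjoint grid cells; the closed cubes [cbox] are compact, as the definition
    of log-concavity demands. *)
Definition hbox (R : realType) (n : nat) (b : 'I_n -> R) (r : R) :
    set 'rV[R]_n :=
  [set x | forall i, b i <= x ord0 i < b i + r].

Lemma measurable_coord (R : realType) (n : nat) (i : 'I_n) :
  measurable_fun setT (fun x : Rn R n => (x : 'rV[R]_n) ord0 i).
Proof.
apply: (measurability _ (RGenOpens.measurableE R)).
move=> _ [_ [a [b ->] <-]]; rewrite setTI.
apply: sub_sigma_algebra.
have /continuousP := @coord_continuous R 1 n ord0 i.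
apply; exact: interval_open.
Qed.

Lemma measurable_hbox (R : realType) (n : nat) (b : 'I_n -> R) (r : R) :
  measurable (hbox R n b r : set (Rn R n)).
Proof.
rewrite (_ : hbox R n b r = \bigcap_(i in setT)
   (setT `&` (fun x : Rn R n => (x : 'rV[R]_n) ord0 i) @^-1`
     `[b i, b i + r[%classic)).
  apply: fin_bigcap_measurable; first exact: finite_finset.
  by move=> i _; apply: measurable_coord.
apply/seteqP; split => [x bx i _|x bx i].
  by split => //=; rewrite in_itv/=.
by have [_ /=] := bx i I; rewrite in_itv.
Qed.

Lemma measurable_cbox (R : realType) (n : nat) (b : 'I_n -> R) (r : R) :
  measurable (cbox R n b r : set (Rn R n)).
Proof.
rewrite (_ : cbox R n b r = \bigcap_(i in setT)
   (setT `&` (fun x : Rn R n => (x : 'rV[R]_n) ord0 i) @^-1`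
     `[b i, b i + r]%classic)).
  apply: fin_bigcap_measurable; first exact: finite_finset.
  by move=> i _; apply: measurable_coord.
apply/seteqP; split => [x bx i _|x bx i].
  by split => //=; rewrite in_itv/=.
by have [_ /=] := bx i I; rewrite in_itv.
Qed.

Lemma measurable_halfspace (R : realType) (n : nat) (u : 'rV[R]_n) (a : R) :
  measurable ([set y | a <= dotRn u y] : set (Rn R n)).
Proof.
have mu : measurable_fun setT (fun y : Rn R n => dotRn u (y : 'rV[R]_n)).
  apply: measurable_sum => i; apply: measurable_funM => //.
  exact: measurable_coord.
rewrite -[X in measurable X]setTI.
by apply: (measurable_fun_le _ _ mu) => //; exact: measurable_cst.
Qed.

Lemma compact_cbox (R : realType) (n : nat) (b : 'I_n -> R) (r : R) :
  compact (cbox R n b r).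
Proof.
rewrite (_ : cbox R n b r =
    [set v : 'rV[R]_n | forall i, `[b i, b i + r]%classic (v ord0 i)]).
  apply: (@rV_compact R n (fun i => `[b i, b i + r]%classic)) => i.
  exact: segment_compact.
by apply/seteqP; split => x bx i; have := bx i; rewrite /= in_itv.
Qed.

Lemma minkowski_comb_cbox (R : realType) (n : nat) (b b' : 'I_n -> R) (r : R) :
  minkowski_comb 2^-1 (cbox R n b r) (cbox R n b' r) =
  cbox R n (fun i => (b i + b' i) / 2) r.
Proof.
apply/seteqP; split => [_ [y yb [z zb <-]] i|x xb].
  by have := yb i; have := zb i; rewrite !mxE; lra.
(* The offset of x from the corner of the middle cube is added to the corners b and b'; the two
   points obtained have midpoint x. *)
exists (\row_i (x ord0 i - (b i + b' i) / 2 + b i)).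
  by move=> i; rewrite mxE; have := xb i; lra.
exists (\row_i (x ord0 i - (b i + b' i) / 2 + b' i)).
  by move=> i; rewrite mxE; have := xb i; lra.
by apply/rowP => i; rewrite !mxE; lra.
Qed.

Lemma fine_probability_le (d : measure_display) (X : measurableType d)
    (R : realType) (P : probability X R) (A B : set X) :
  measurable A -> measurable B -> A `<=` B -> fine (P A) <= fine (P B).
Proof.
move=> mA mB AB; apply: fine_le; rewrite ?fin_num_measure//.
by apply: le_measure => //; rewrite inE.
Qed.

Lemma log_concave_hbox (R : realType) (n : nat) (mu : probability (Rn R n) R)
    (b b' : 'I_n -> R) (r : R) : log_concave mu ->
  Num.sqrt (fine (mu (hbox R n b r))) * Num.sqrt (fine (mu (hbox R n b' r))) <=
  fine (mu (cbox R n (fun i => (b i + b' i) / 2) r)).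
Proof.
move=> [lc _].
have hc c : Num.sqrt (fine (mu (hbox R n c r))) <=
    Num.sqrt (fine (mu (cbox R n c r))).
  apply: ler_wsqrtr; apply: fine_probability_le.
  - exact: measurable_hbox.
  - exact: measurable_cbox.
  - by move=> x xc i; have := xc i; lra.
apply: le_trans (ler_pM _ _ (hc b) (hc b')) _; rewrite ?sqrtr_ge0//.
have := lc _ _ 2^-1 (compact_cbox R n b r) (compact_cbox R n b' r) _.
rewrite minkowski_comb_cbox (_ : 1 - 2^-1 = 2^-1 :> R); last by lra.
rewrite !powR12_sqrt ?fine_ge0// => H.
rewrite -lee_fin fineK; first by apply: H; lra.
apply: fin_num_measure; exact: measurable_cbox.
Qed.

(** Half the lower bound obtained for the mean of [depth_minorant]; it serves both as a level of
    depth and as a bound on the measure of the points reaching it. *)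
Definition depth_bound (R : realType) (n : nat) : R :=
  (64 * 3 ^+ (3 * n))^-1.

Lemma depth_bound_gt0 (R : realType) (n : nat) : 0 < depth_bound R n.
Proof. by rewrite invr_gt0 mulr_gt0// exprn_gt0. Qed.

(** * A grid of mesh [r] and the midpoints of its cells *)

Section grid.
Context (R : realType) (n N : nat).
Variables (a r : R).
Hypothesis r_gt0 : 0 < r.

Let K := {ffun 'I_n -> 'I_N.+1}.

Definition corner (k : K) (i : 'I_n) : R := r * (k i)%:R - a.
Definition cell (k : K) := hbox R n (corner k) r.
Definition mid (k l : K) :=
  cbox R n (fun i => (corner k i + corner l i) / 2) r.

Lemma midC k l : mid k l = mid l k.
Proof. by congr cbox; apply/funext => i; rewrite addrC. Qed.

Lemma cell_inj k l x : cell k x -> cell l x -> k = l.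
Proof.
move=> xk xl; apply/ffunP => i; apply/val_inj => /=.
have := xk i; have := xl i; rewrite /corner => /andP[l1 l2] /andP[k1 k2].
apply/eqP; rewrite eqn_leq; apply/andP; split.
  rewrite -ltnS -(ltr_nat R) -natr1 -(ltr_pM2l r_gt0); lra.
rewrite -ltnS -(ltr_nat R) -natr1 -(ltr_pM2l r_gt0); lra.
Qed.

Lemma cell_cover x : 2 * a <= r * N.+1%:R ->
  hbox R n (fun=> - a) (2 * a) x -> exists k, cell k x.
Proof.
move=> aN xa; pose t i := (x ord0 i + a) / r.
have t0 i : 0 <= t i.
  by rewrite divr_ge0 ?(ltW r_gt0)//; have := xa i => /=; lra.
have tr i : x ord0 i = r * t i - a by rewrite /t; field; rewrite gt_eqF.
have tN i : (Num.truncn (t i) < N.+1)%N.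
  rewrite truncn_lt_nat// ltr_pdivrMr// mulrC; have := xa i => /=; lra.
exists [ffun i => inord (Num.truncn (t i))] => i.
rewrite /corner ffunE inordK// tr.
have /andP[] := truncn_itv (t0 i).
rewrite -natr1 -(ler_pM2l r_gt0) -(ltr_pM2l r_gt0); lra.
Qed.

(* On the indices l with x in mid k l each coordinate of l ranges over an
   interval of length 2, so l is determined by its residues modulo 3. *)
Lemma sum_mid_le k x : \sum_l \1_(mid k l) x <= 3 ^+ n :> R.
Proof.
under eq_bigr do rewrite indicE.
rewrite -natr_sum -natrX ler_nat.
have -> : (\sum_l (x \in mid k l) = #|[pred l | x \in mid k l]|)%N.
  rewrite -sum1_card [RHS]big_mkcond; apply: eq_bigr => l _.
  by rewrite inE; case: (_ \in _).
pose f (l : K) : {ffun 'I_n -> 'I_3} := [ffun i => inord (l i %% 3)].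
rewrite -[X in (_ <= X ^ _)%N](card_ord 3) -[X in (_ <= _ ^ X)%N](card_ord n).
rewrite -card_ffun.
have fI : {in [pred l | x \in mid k l] &, injective f}.
  move=> l l'; rewrite !inE => xl xl' /ffunP fl.
  apply/ffunP => i; apply/val_inj => /=.
  have := congr1 (@nat_of_ord 3) (fl i); rewrite !ffunE !inordK ?ltn_pmod// => e.
  have := xl i; have := xl' i; rewrite /corner => /andP[l1 l2] /andP[k1 k2].
  have h1 : (l i <= l' i + 2)%N.
    by rewrite -(ler_nat R) natrD -(ler_pM2l r_gt0); lra.
  have h2 : (l' i <= l i + 2)%N.
    by rewrite -(ler_nat R) natrD -(ler_pM2l r_gt0); lra.
  by lia.
by rewrite -(card_in_image fI) max_card.
Qed.

(** The point x is the midpoint of points of the two closed cells, one of which lies in the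
    half-space. On a cube of side r the form u varies by at most r times the l1-norm of u, so the
    widening captures the whole cell. *)
Lemma cell_sub_widened_halfspace (k l : K) (x u : 'rV[R]_n) (c : R) :
  mid k l x -> c <= dotRn u x ->
  let H := [set y | c - r * \sum_i `|u ord0 i| <= dotRn u y] in
  cell k `<=` H \/ cell l `<=` H.
Proof.
move=> xm cx H.
have near (j : K) y z : cbox R n (corner j) r y -> c <= dotRn u y ->
    cell j z -> H z.
  move=> yj cy zj; rewrite /H/= lerBlDr; apply: (le_trans cy).
  rewrite -lerBlDl /dotRn -sumrB mulr_sumr; apply: ler_sum => i _.
  rewrite -mulrBr; apply: (le_trans (ler_norm _)).
  rewrite normrM mulrC ler_wpM2r// ler_norml.
  by have := yj i; have := zj i; lra.
move: xm cx; rewrite /mid -minkowski_comb_cbox => -[y yk [z zl <-]] cx.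
have e : dotRn u (2^-1 *: y + (1 - 2^-1) *: z) = (dotRn u y + dotRn u z) / 2.
  rewrite /dotRn -big_split mulr_suml; apply: eq_bigr => i _.
  by rewrite !mxE/=; lra.
have [cy|cy] := leP c (dotRn u y).
  by left => w; exact: near yk cy.
by right => w; apply: near zl _; rewrite e in cx; lra.
Qed.

(** * A discrete minorant of the depth *)

Section depth.
Variable mu : probability (Rn R n) R.

Let p k := fine (mu (cell k)).

(** Discrete form of (1/2) int min(f(x+v), f(x-v)) dv, with pairs of cells for the points x+v and
    x-v; the factor 3^n compensates for the overlap of the cubes [mid k l]. *)
Definition depth_minorant (x : 'rV[R]_n) : R :=
  \sum_(kl : K * K)
    (2 * 3 ^+ n)^-1 * Num.min (p kl.1) (p kl.2) * \1_(mid kl.1 kl.2) x.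

Let p_ge0 k : 0 <= p k. Proof. exact: fine_ge0. Qed.

Let w_ge0 (kl : K * K) : 0 <= (2 * 3 ^+ n)^-1 * Num.min (p kl.1) (p kl.2).
Proof.
by rewrite mulr_ge0// ?invr_ge0 ?mulr_ge0 ?exprn_ge0// le_min !p_ge0.
Qed.

(** Each minimum is charged to a cell of its pair contained in H. A cell is charged at most 3^n
    times in each of the two positions, and the cells inside H are disjoint. *)
Lemma depth_minorant_le (x : 'rV[R]_n) (H : set 'rV[R]_n) :
  measurable (H : set (Rn R n)) ->
  (forall k l, mid k l x -> cell k `<=` H \/ cell l `<=` H) ->
  depth_minorant x <= fine (mu H).
Proof.
move=> mH midH; pose h k : R := `[< cell k `<=` H >]%:R.
have h0 k : 0 <= h k by [].
have ph : \sum_k p k * h k <= fine (mu H).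
  have := @sum_measure_le _ (Rn R n) R mu K unit h (fun=> 1) cell (fun=> H).
  rewrite !big_const card_unit/= addr0 mul1r => le.
  under eq_bigr do rewrite mulrC; apply: le => //.
    by move=> k; exact: measurable_hbox.
  move=> y; rewrite big_const card_unit/= addr0 mul1r.
  have [[k yk]|ny] := pselect (exists k, cell k y); last first.
    rewrite big1// => k _; rewrite indicE memNset ?mulr0// => yk.
    by apply: ny; exists k.
  rewrite (bigD1 k)//= big1 ?addr0; last first.
    move=> l lk; rewrite indicE memNset ?mulr0// => yl.
    by move/eqP: lk; apply; exact: cell_inj yl yk.
  rewrite /h; case: asboolP => [kH|_]; rewrite ?mul0r// mul1r.
  by rewrite !indicE !mem_set//; exact: kH.
apply: le_trans ph.
rewrite /depth_minorant; under eq_bigr do rewrite -mulrA.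
rewrite -mulr_sumr ler_pdivrMl ?mulr_gt0 ?exprn_gt0//.
have le (k l : K) : Num.min (p k) (p l) * \1_(mid k l) x <=
    p k * h k * \1_(mid k l) x + p l * h l * \1_(mid l k) x.
  rewrite [mid l k]midC -mulrDl; rewrite indicE.
  have [/set_mem xm|_] := boolP (x \in mid k l); last by rewrite !mulr0.
  rewrite !mulr1 ge_min; have [kH|lH] := midH _ _ xm.
    have -> : h k = 1 by rewrite /h asboolT.
    by rewrite mulr1 lerDl mulr_ge0.
  have -> : h l = 1 by rewrite /h asboolT.
  by rewrite mulr1 [X in _ || X]lerDr mulr_ge0 ?orbT.
rewrite -(pair_big xpredT xpredT
  (fun k l => Num.min (p k) (p l) * \1_(mid k l) x))/=.
have sum_le : \sum_k \sum_l p k * h k * \1_(mid k l) x <=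
    3 ^+ n * \sum_k p k * h k.
  rewrite mulr_sumr; apply: ler_sum => k _; rewrite -mulr_sumr mulrC.
  by rewrite ler_wpM2r ?mulr_ge0// sum_mid_le.
apply: (@le_trans _ _ (\sum_k \sum_l (p k * h k * \1_(mid k l) x +
    p l * h l * \1_(mid l k) x))).
  by apply: ler_sum => k _; apply: ler_sum => l _; exact: le.
rewrite (_ : \sum_k _ = (\sum_k \sum_l p k * h k * \1_(mid k l) x) +
    \sum_k \sum_l p l * h l * \1_(mid l k) x); last first.
  by rewrite -big_split; apply: eq_bigr => k _; rewrite -big_split.
(* After the exchange both double sums are the one bounded by [sum_le]. *)
by rewrite [X in _ + X]exchange_big/=; lra.
Qed.

(** The sum is the mean of [depth_minorant]. [sum_min_ge] with T = 3^n bounds it: 32 * 3^(3n) is 16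
    * 3^(2n) times the normalisation 2 * 3^n. *)
Lemma sum_depth_minorant_ge : log_concave mu -> 2 * a <= r * N.+1%:R ->
  2^-1 <= fine (mu (hbox R n (fun=> - a) (2 * a))) ->
  (32 * 3 ^+ (3 * n))^-1 <= \sum_(kl : K * K)
    (2 * 3 ^+ n)^-1 * Num.min (p kl.1) (p kl.2) * fine (mu (mid kl.1 kl.2)).
Proof.
move=> lc aN box.
have T0 : 0 < 3 ^+ n :> R by rewrite exprn_gt0.
have sp : 2^-1 <= \sum_k p k.
  apply: (le_trans box).
  have := @sum_measure_le _ (Rn R n) R mu unit K (fun=> 1) (fun=> 1)
    (fun=> hbox R n (fun=> - a) (2 * a)) cell.
  rewrite big_const card_unit/= addr0 mul1r => le.
  rewrite (_ : \sum_k p k = \sum_k 1 * p k); last first.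
    by apply: eq_bigr => k _; rewrite mul1r.
  apply: le => //.
  - by move=> _; exact: measurable_hbox.
  - by move=> k; exact: measurable_hbox.
  move=> x; rewrite big_const card_unit/= addr0 mul1r [leLHS]indicE.
  have [/set_mem xb|_] := boolP (_ \in _); last first.
    by apply: sumr_ge0 => k _; rewrite mul1r.
  have [k xk] := cell_cover _ aN xb.
  rewrite (bigD1 k)//= mul1r [X in X + _]indicE mem_set// lerDl.
  by apply: sumr_ge0 => l _; rewrite mul1r.
have qT l : \sum_k fine (mu (mid k l)) <= 3 ^+ n.
  have := @sum_measure_le _ (Rn R n) R mu K unit (fun=> 1) (fun=> 3 ^+ n)
    (fun k => mid k l) (fun=> setT).
  rewrite big_const card_unit/= addr0 probability_setT/= mulr1 => le.
  rewrite (_ : \sum_k _ = \sum_k 1 * fine (mu (mid k l))); last first.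
    by apply: eq_bigr => k _; rewrite mul1r.
  apply: le => //.
  - by move=> k; exact: measurable_cbox.
  move=> x; rewrite big_const card_unit/= addr0 [X in _ * X]indicE in_setT mulr1.
  apply: le_trans (sum_mid_le l x).
  by apply: ler_sum => k _; rewrite mul1r midC.
have := sum_min_ge R K p (fun k l => fine (mu (mid k l))) _ T0 p_ge0 sp _ qT.
move=> /(_ (fun k l => log_concave_hbox _ _ _ _ _ _ lc)).
rewrite pair_big/= => le.
under eq_bigr do rewrite -mulrA; rewrite -mulr_sumr.
have -> : (32 * 3 ^+ (3 * n))^-1 =
    (2 * 3 ^+ n)^-1 * (16 * (3 ^+ n) ^+ 2)^-1 :> R.
  by rewrite mulnC exprM; field; rewrite gt_eqF.
by rewrite ler_wpM2l// invr_ge0 mulr_ge0// ltW.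
Qed.

Lemma measurable_depth_minorant (c : R) :
  measurable ([set x | c <= depth_minorant x] : set (Rn R n)).
Proof.
rewrite -[X in measurable X]setTI; apply: measurable_fun_le => //.
apply: measurable_sum => kl; apply: measurable_funM => //.
apply: measurable_indic; exact: measurable_cbox.
Qed.

Lemma probability_depth_minorant_ge :
  log_concave mu -> 2 * a <= r * N.+1%:R ->
  2^-1 <= fine (mu (hbox R n (fun=> - a) (2 * a))) ->
  ((depth_bound R n)%:E <=
    mu ([set x | (depth_bound R n <= depth_minorant x)%R] : set (Rn R n)))%E.
Proof.
move=> lc aN box; apply: probability_sum_ge => //.
- exact/ltW/depth_bound_gt0.
- by move=> kl; exact: measurable_cbox.
(* Taking the whole space for H shows that the minorant is at most 1. *)
- move=> x; have := @depth_minorant_le x setT measurableT.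
  by rewrite probability_setT; apply => k l _; left.
- have := sum_depth_minorant_ge lc aN box; apply: le_trans.
  have T0 : 0 < 3 ^+ (3 * n) :> R by rewrite exprn_gt0.
  rewrite /depth_bound le_eqVlt; apply/orP; left; apply/eqP.
  by field; rewrite gt_eqF.
Qed.

End depth.
End grid.

(** * A large cube, and the passage to mesh 0 *)

Lemma probability_big_box (R : realType) (n : nat)
    (mu : probability (Rn R n) R) :
  exists a : R, 2^-1 <= fine (mu (hbox R n (fun=> - a) (2 * a))).
Proof.
apply: contrapT => /forallNP small.
(* The cubes [-j, j)^n increase to the whole space, so their measures cannot all stay below 1/2. *)
pose F j : set (Rn R n) := hbox R n (fun=> - j%:R) (2 * j%:R).
have mF j : measurable (F j) by exact: measurable_hbox.
have FT : \bigcup_j F j = setT.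
  apply/seteqP; split => // x _.
  pose s := \sum_i `|(x : 'rV[R]_n) ord0 i|.
  have s0 : 0 <= s by exact: sumr_ge0.
  exists (Num.truncn s).+1 => // i.
  have /andP[_] := truncn_itv s0; set t := (Num.truncn s).+1%:R => st.
  have : `|(x : 'rV[R]_n) ord0 i| <= s.
    by rewrite /s (bigD1 i)//= lerDl; exact: sumr_ge0.
  by move=> /(le_lt_trans)/(_ st); rewrite ltr_norml; lra.
have ndF : {homo F : i j / (i <= j)%N >-> (i <= j)%O}.
  move=> i j ij; apply/subsetPset => x xi k.
  have ijR : i%:R <= j%:R :> R by rewrite ler_nat.
  by have := xi k => /=; lra.
have := nondecreasing_cvg_mu (mu := mu) mF _ ndF.
rewrite FT => /(_ measurableT) cvgF.
have : (mu setT <= (2^-1)%:E)%E.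
  apply: (cvge_le _ cvgF); apply: nearW => j /=.
  rewrite -(EFin_fine_probability _ _ _ _ _ (mF j)) lee_fin.
  by rewrite leNgt; apply/negP => /ltW /small.
by rewrite probability_setT lee_fin; lra.
Qed.

Lemma tukey_depth_ge0 (R : realType) (n : nat) (mu : probability (Rn R n) R)
    (x : 'rV[R]_n) : (0 <= tukey_depth mu x)%E.
Proof. by apply: le_ereal_inf_tmp => _ [H _ <-]. Qed.

(* The closed half-space H is the decreasing intersection of its widenings, so
   a lower bound on their measures passes to H although mu may charge the
   boundary of H. *)
Lemma widened_halfspace_ge (R : realType) (n : nat)
    (mu : probability (Rn R n) R) (u : 'rV[R]_n) (a s : R) (c : \bar R) :
  0 <= s ->
  (forall j : nat,
     (c <= mu ([set y | (a - j.+1%:R^-1 * s <= dotRn u y)%R] : set (Rn R n)))%E) ->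
  (c <= mu ([set y | (a <= dotRn u y)%R] : set (Rn R n)))%E.
Proof.
move=> s0 cF.
pose F j : set (Rn R n) := [set y | a - j.+1%:R^-1 * s <= dotRn u y].
have mF j : measurable (F j) by exact: measurable_halfspace.
have FH : \bigcap_j F j = [set y | a <= dotRn u y].
  apply/seteqP; split => [y Fy|y /= ay j _]; last first.
    by apply: le_trans ay; rewrite lerBlDr lerDl mulr_ge0.
  (* If y misses the half-space by e, the widening of index floor(s/e) is narrower than e and
     already excludes y. *)
  rewrite /= leNgt; apply/negP => ya; set e := a - dotRn u y.
  have e0 : 0 < e by rewrite subr_gt0.
  have se : 0 <= s / e by rewrite divr_ge0// ltW.
  have /andP[_ ] := truncn_itv se.
  rewrite ltr_pdivrMr// => lt.
  have := Fy (Num.truncn (s / e)) I; rewrite /F/= lerBlDr -lerBlDl -/e.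
  by rewrite ler_pdivlMl//; lra.
have niF : {homo F : i j / (i <= j)%N >-> (j <= i)%O}.
  move=> i j ij; apply/subsetPset => y; apply: le_trans.
  by rewrite lerB// ler_wpM2r// lef_pV2 ?posrE// ler_nat.
have := nonincreasing_cvg_mu (mu := mu) (F := F).
rewrite FH => cvgF.
apply: (cvge_ge _ (cvgF _ mF (measurable_halfspace _ _ _ _) niF)).
  by apply: nearW => j; exact: cF.
by apply: le_lt_trans (probability_le1 mu (mF 0%N)) _; exact: ltry.
Qed.

(** For each mesh the minorant is at least [depth_bound] on a set A_j of measure at least
    [depth_bound]. The A_j need not be nested, so E is their limit superior: it keeps the measure
    bound, and its points lie in A_k for arbitrarily fine meshes. *)
Lemma tukey_depth_large (R : realType) (n : nat) (mu : probability (Rn R n) R) :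
  log_concave mu ->
  exists E : set (Rn R n), [/\ measurable E, ((depth_bound R n)%:E <= mu E)%E &
    forall x, E x -> ((depth_bound R n)%:E <= tukey_depth mu x)%E].
Proof.
move=> lc; have [a abox] := probability_big_box _ _ mu.
set c := depth_bound R n.
pose r j : R := j.+1%:R^-1.
have r0 j : 0 < r j by rewrite invr_gt0.
pose N j := Num.truncn (2 * a / r j).
have aN j : 2 * a <= r j * (N j).+1%:R.
  by rewrite -ler_pdivrMl// mulrC; exact: ltW (truncnS_gt _).
pose A j : set (Rn R n) := [set x | c <= depth_minorant R n (N j) a (r j) mu x].
have mA j : measurable (A j) by exact: measurable_depth_minorant.
have cA j : (c%:E <= mu (A j))%E.
  exact: probability_depth_minorant_ge (r0 j) _ lc (aN j) abox.
have mU j : measurable (\bigcup_(k in [set k | (j <= k)%N]) A k).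
  exact: bigcup_measurable.
exists (lim_sup_set A); split.
- exact: bigcap_measurableType.
- have /(lim_sup_set_cvg mu A mA) cvgA :
      (mu (\bigcup_(k in [set k | (0 <= k)%N]) A k) < +oo)%E.
    by apply: le_lt_trans (probability_le1 mu (mU 0%N)) _; exact: ltry.
  apply: (cvge_ge _ cvgA).
  apply: nearW => j; apply: (le_trans (cA j)); apply: le_measure.
  + by rewrite inE.
  + by rewrite inE.
  + by move=> x Ax; exists j => /=.
- move=> x Ex; apply: le_ereal_inf_tmp => _ [_ [[u [b [_ ->]]] bx] <-].
  apply: (widened_halfspace_ge _ _ _ _ _ (\sum_i `|u ord0 i|)).
    exact: sumr_ge0.
  (* A mesh k >= j with x in A_k is used; widening by r_k stays within the widening by r_j. *)
  move=> j; have [k /= jk ck] := Ex j I.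
  set H := (X in mu X).
  have mH : measurable (H : set (Rn R n)) by exact: measurable_halfspace.
  rewrite -(EFin_fine_probability _ _ _ _ _ mH) lee_fin; apply: (le_trans ck).
  apply: depth_minorant_le => // k1 k2 xm.
  have sub : [set y | b - r k * \sum_i `|u ord0 i| <= dotRn u y] `<=` H.
    move=> y; apply: le_trans.
    by rewrite lerB// ler_wpM2r ?sumr_ge0// lef_pV2 ?posrE// ler_nat.
  have [h|h] := cell_sub_widened_halfspace _ _ _ _ _ _ _ _ _ _ xm bx.
    by left; exact: subset_trans sub.
  by right; exact: subset_trans sub.
Qed.

(** * The bound on the integral of the depth *)

Theorem theorem1p3 (R : realType) :
  exists c : R, 0 < c /\
    forall (n : nat) (mu : probability (Rn R n) R),
      (1 <= n)%N -> log_concave mu ->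
      ((expR (- (c * n%:R)))%:E <= \int[mu]_x tukey_depth mu x)%E.
Proof.
(* Since n >= 1, 64 * 3^(3n) <= B^n; the factor 2 is there because the integral is bounded below by
   the square of [depth_bound]. *)
pose B : R := 64 * 3 ^+ 3; have B1 : 1 < B by rewrite /B; lra.
exists (2 * ln B); split; first by rewrite mulr_gt0// ln_gt0.
move=> n mu n1 lc; have [E [mE cE dE]] := tukey_depth_large _ _ _ lc.
have c0 := depth_bound_gt0 R n.
have := integral_ge_indic _ (Rn R n) R mu (tukey_depth mu) _ _
  (tukey_depth_ge0 R n mu) (ltW c0) mE dE.
apply: le_trans.
apply: (@le_trans _ _ ((depth_bound R n)%:E * (depth_bound R n)%:E)%E).
  have e : expR (- (2 * ln B * n%:R)) = ((B ^+ n)^-1) ^+ 2 :> R.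
    by rewrite expRN -mulrA expRM_natl expRM_natr lnK ?posrE ?exprVn//; lra.
  have le : (B ^+ n)^-1 <= depth_bound R n.
    have B0 : 0 < B by lra.
    rewrite lef_pV2 ?posrE ?mulr_gt0 ?exprn_gt0//.
    rewrite /B exprMn -exprM ler_wpM2r ?exprn_ge0//.
    by rewrite -[leLHS]expr1 ler_weXn2l//; lra.
  rewrite -EFinM lee_fin -expr2 e lerXn2r ?nnegrE ?invr_ge0 ?exprn_ge0//.
  by lra.
by rewrite lee_wpmul2l// lee_fin ltW.
Qed.
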